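(* There is an absolute constant $C>0$ such that the following holds. Let $\mathcal{G}=(G_1,\dots,G_T)$ be an always-connected temporal graph on $n\ge 2$ vertices whose underlying graph has treewidth at most $k$, where $k\ge 1$, and suppose $T\ge C\,n^{4/3}k^{5.5}\log^{2.5}(n)$. Then a single agent starting at any given vertex can visit all vertices of $\mathcal{G}$ using only the snapshots $G_1,\dots,G_{\lceil C n^{4/3}k^{5.5}\log^{2.5}(n)\rceil}$.
   Context: A temporal graph $\mathcal{G}=(G_1,\dots,G_T)$ on a vertex set $V$ is a sequence of simple undirected graphs (snapshots) $G_t=(V,E_t)$. It is always-connected if every $G_t$ is connected. Its underlying graph is $(V,\bigcup_t E_t)$. A temporal walk is a sequence $((v_0,v_1),t_1),\dots,((v_{\ell-1},v_\ell),t_\ell)$ with $\{v_{j-1},v_j\}\in E_{t_j}$ and $t_1<\dots<t_\ell$. The agent may wait at vertices between steps. The walk visits $v_0,\dots,v_\ell$, and it uses only the snapshots $G_1,\dots,G_{T'}$ if all $t_j\le T'$. *)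

(* Defs.v *)
From mathcomp Require Import all_boot all_order all_algebra.
From mathcomp Require Import all_classical all_reals all_analysis.

Set Implicit Arguments.
Unset Strict Implicit.
Unset Printing Implicit Defensive.

Import Order.TTheory GRing.Theory Num.Theory.

(** * Simple graphs *)

Record sgraph (V : finType) := SGraph {
  adj :> rel V;
  adj_sym : symmetric adj;
  adj_irr : irreflexive adj }.

(* Any two vertices of S are joined by a path staying inside S; vacuous for
   S empty. *)
Definition connected_in (V : finType) (G : sgraph V) (S : {set V}) : Prop :=
  {in S &, forall x y,
    connect [rel a b | [&& a \in S, b \in S & G a b]] x y}.

Definition connected_graph (V : finType) (G : sgraph V) : Prop :=
  0 < #|V| /\ connected_in G [set: V].

(* A ucycle is a duplicate-free cyclic sequence of adjacent vertices. Those of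
   size 2 are the edges traversed back and forth, which are not cycles. *)
Definition acyclic_graph (V : finType) (G : sgraph V) : Prop :=
  forall c : seq V, ucycle G c -> size c < 3.

Definition is_tree (V : finType) (G : sgraph V) : Prop :=
  connected_graph G /\ acyclic_graph G.

(** * Treewidth *)

Record tree_decomposition (V : finType) (G : sgraph V) := TreeDecomposition {
  td_node : finType;
  td_tree : sgraph td_node;
  td_bag : td_node -> {set V};
  td_treeP : is_tree td_tree;
  td_vertex : forall v, exists i, v \in td_bag i;
  td_edge : forall u v, G u v -> exists i, u \in td_bag i /\ v \in td_bag i;
  td_subtree : forall v, connected_in td_tree [set i | v \in td_bag i] }.

Definition td_width (V : finType) (G : sgraph V) (D : tree_decomposition G) :
  nat := (\max_(i : td_node D) #|td_bag i|).-1.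

Lemma adj0_sym (V : finType) : symmetric [rel _ _ : V | false].
Proof. by []. Qed.

Lemma adj0_irr (V : finType) : irreflexive [rel _ _ : V | false].
Proof. by []. Qed.

Definition edgeless (V : finType) : sgraph V :=
  SGraph (@adj0_sym V) (@adj0_irr V).

Lemma is_tree_unit : is_tree (edgeless unit).
Proof.
split; first by split; [rewrite card_unit | move=> [] [] _ _; exact: connect0].
by case=> [|[] [|[] c]] // /andP[].
Qed.

Definition trivial_td (V : finType) (G : sgraph V) : tree_decomposition G.
Proof.
refine (@TreeDecomposition V G unit (edgeless unit) (fun=> [set: V])
  is_tree_unit _ _ _).
- by move=> v; exists tt; rewrite inE.
- by move=> u v _; exists tt; rewrite !inE.
- by move=> v [] [] _ _; exact: connect0.
Defined.

Lemma ex_td_width (V : finType) (G : sgraph V) :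
  exists w, `[< exists D : tree_decomposition G, td_width D = w >].
Proof. by exists (td_width (trivial_td G)); apply/asboolP; exists (trivial_td G). Qed.

Definition treewidth (V : finType) (G : sgraph V) : nat :=
  ex_minn (ex_td_width G).

(** * Temporal graphs *)

(* The snapshot G_t, for t in {1, ..., T}, is the value at the ordinal t - 1. *)
Definition temporal_graph (V : finType) (T : nat) := 'I_T -> sgraph V.

Definition always_connected (V : finType) (T : nat) (G : temporal_graph V T) :
  Prop := forall t, connected_graph (G t).

Lemma underlying_sym (V : finType) (T : nat) (G : temporal_graph V T) :
  symmetric [rel u v | [exists t, G t u v]].
Proof. by move=> u v /=; apply: eq_existsb => t; rewrite adj_sym. Qed.

Lemma underlying_irr (V : finType) (T : nat) (G : temporal_graph V T) :
  irreflexive [rel u v | [exists t, G t u v]].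
Proof. by move=> u /=; apply/existsP => -[t]; rewrite adj_irr. Qed.

Definition underlying_graph (V : finType) (T : nat) (G : temporal_graph V T) :
  sgraph V := SGraph (underlying_sym G) (underlying_irr G).

(** * Temporal walks *)

(* ((u, v), t) is the move from u to v along an edge of the snapshot indexed
   by t. *)
Definition temporal_step (V : finType) (T : nat) := ((V * V) * 'I_T)%type.

Fixpoint consecutive_steps (V : finType) (T : nat) (v0 : V)
    (w : seq (temporal_step V T)) : bool :=
  if w is s :: w' then (s.1.1 == v0) && consecutive_steps s.1.2 w' else true.

Definition temporal_walk (V : finType) (T : nat) (G : temporal_graph V T)
    (v0 : V) (w : seq (temporal_step V T)) : bool :=
  [&& consecutive_steps v0 w,
      all (fun s => G s.2 s.1.1 s.1.2) w &
      sorted ltn [seq val s.2 | s <- w]].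

Definition visited (V : finType) (T : nat) (v0 : V)
    (w : seq (temporal_step V T)) : seq V :=
  v0 :: [seq s.1.2 | s <- w].

(* The step with index s.2 takes place in the snapshot G_(s.2 + 1). *)
Definition uses_only_first (V : finType) (T : nat) (T' : nat)
    (w : seq (temporal_step V T)) : bool :=
  all (fun s : temporal_step V T => (val s.2).+1 <= T') w.

Local Open Scope ring_scope.

Definition exploration_bound (R : realType) (C : R) (n k : nat) : R :=
  C * n%:R `^ (4 / 3) * k%:R `^ (11 / 2) * ln n%:R `^ (5 / 2).

(* Main.v *)
(**
Let [D] be a vertex set attached to the rest of the underlying graph through a
boundary [B], and let [v] be in [D]. The set reachable from [v] inside [D] and
the set from which [v] can be reached each grow fewer than [#|D|] times, so in a
window of [2 #|D|] steps they are simultaneously stable at some moment; the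
component of [v] in that snapshot then meets [B], which yields [b] in [B] such
that both [v] reaches [b] and [b] reaches [v] within the window. By the
pigeonhole principle the same [b] occurs in two of [#|B| + 1] consecutive
windows, so an agent waiting at [b] can visit [v] and come back to [b].

The argument iterates. If a sub-piece of [D] with boundary [B'] can be toured
from a home in [B'], then it can be toured from a home in [B] in about
[#|B'| #|B|] windows, and giving each of several sub-pieces its own stretch of
time, the most frequent home in [B] collects a fraction [1 / #|B|] of what is
visited. Balanced separators cut the graph into about [n^(1/3)] pieces, each
consisting of about [n^(1/3)] sub-pieces of about [n^(1/3)] vertices, all with
boundary O(k), up to factors polynomial in [k]. A round of [O(n)] steps per
piece visits a fraction [1 / O(k^2)] of the unvisited vertices, and
[O(k^2 log n)] such rounds visit everything.
*)

Require Import Defs.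
From mathcomp Require Import all_classical all_reals all_analysis.
From mathcomp Require Import all_boot all_order all_algebra.
From mathcomp Require Import zify ring lra.

Set Implicit Arguments.
Unset Strict Implicit.
Unset Printing Implicit Defensive.

Import Order.TTheory GRing.Theory Num.Theory.

(** * Walks with waiting, and reachability inside a vertex set *)

Section Trips.

Variables (V : finType) (H : nat -> sgraph V).

(** One position per snapshot from [s] on; repeating a position means waiting. *)
Fixpoint lazy_walk (s : nat) (x : V) (p : seq V) : bool :=
  if p is y :: p' then ((x == y) || H s x y) && lazy_walk s.+1 y p' else true.

(** The last snapshot available is [t - 1], so a trip starting at [t] can follow. [A] need not be
    everything that is visited. *)
Definition trip (A : {set V}) (s t : nat) (x y : V) : Prop :=
  exists p, [/\ lazy_walk s x p, s + size p = t, last x p = y &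
    {subset A <= x :: p}].

Lemma lazy_walk_cat s x p q :
  lazy_walk s x (p ++ q) = lazy_walk s x p && lazy_walk (s + size p) (last x p) q.
Proof.
elim: p s x => [|y p IHp] s x /=; first by rewrite addn0.
by rewrite IHp addSnnS andbA.
Qed.

Lemma trip_cat A A' s t u x y z :
  trip A s t x y -> trip A' t u y z -> trip (A :|: A') s u x z.
Proof.
move=> [p [wp <- <- sA]] [q [wq <- <- sA']].
exists (p ++ q); split; rewrite ?lazy_walk_cat ?wp ?size_cat ?addnA ?last_cat//.
move=> v; rewrite inE -cat_cons mem_cat => /orP[/sA->//|/sA'].
by rewrite inE => /orP[/eqP->|->]; rewrite ?mem_last ?orbT.
Qed.

Lemma trip_sub (A A' : {set V}) s t x y :
  A' \subset A -> trip A s t x y -> trip A' s t x y.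
Proof.
by move=> /subsetP sA [p [wp st xy sAp]]; exists p; split=> // v /sA /sAp.
Qed.

Lemma trip_wait s t x : s <= t -> trip [set x] s t x x.
Proof.
move=> st; exists (nseq (t - s) x); split.
- by move: (t - s) => m; elim: m s {st} => //= m IHm s; rewrite eqxx IHm.
- by rewrite size_nseq subnKC.
- by elim: (t - s) => //=.
- by move=> v; rewrite !inE => ->.
Qed.

Lemma trip_step s x y : H s x y -> trip finset.set0 s s.+1 x y.
Proof.
move=> xy; exists [:: y]; split; rewrite ?addn1 //= ?xy ?orbT//.
by move=> v; rewrite inE.
Qed.

Lemma trip0_cat A s t u x y z :
  trip finset.set0 s t x y -> trip A t u y z -> trip A s u x z.
Proof. by move=> h /(trip_cat h); rewrite finset.set0U. Qed.

Lemma trip_cat0 A s t u x y z :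
  trip A s t x y -> trip finset.set0 t u y z -> trip A s u x z.
Proof. by move=> h /(trip_cat h); rewrite finset.setU0. Qed.

Lemma trip0_wait s t x : s <= t -> trip finset.set0 s t x x.
Proof. by move=> st; apply: trip_sub (trip_wait x st); rewrite finset.sub0set. Qed.

Lemma trip_widen A s s' t t' x y :
  s' <= s -> t <= t' -> trip A s t x y -> trip A s' t' x y.
Proof.
move=> ss tt h; apply: trip0_cat (trip0_wait x ss) _.
exact: trip_cat0 h (trip0_wait y tt).
Qed.

Variable D : {set V}.

Fixpoint reach_from (s : nat) (v : V) (m : nat) : {set V} :=
  if m is m'.+1 then
    let Q := reach_from s v m' in
    Q :|: [set y in D | [exists x in Q, H (s + m') x y]]
  else [set v].

(** Built backwards from the deadline [t]: round [m] prepends a move in the snapshot [t - m]. *)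
Fixpoint reach_to (t : nat) (v : V) (m : nat) : {set V} :=
  if m is m'.+1 then
    let P := reach_to t v m' in
    P :|: [set x in D | [exists y in P, H (t - m) x y]]
  else [set v].

Lemma reach_from_trip s v m y :
  y \in reach_from s v m -> trip finset.set0 s (s + m) v y.
Proof.
elim: m y => [|m IHm] y /=.
  by rewrite inE => /eqP ->; apply: trip0_wait; rewrite addn0.
rewrite !inE => /orP[/IHm|/andP[_ /exists_inP[x /IHm h xy]]].
  by apply: trip_widen; rewrite ?addnS.
by rewrite addnS; apply: trip_cat0 h (trip_step xy).
Qed.

Lemma reach_to_trip t v m x : m <= t ->
  x \in reach_to t v m -> trip finset.set0 (t - m) t x v.
Proof.
elim: m x => [|m IHm] x /= mt.
  by rewrite inE => /eqP ->; apply: trip0_wait; rewrite subn0.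
rewrite !inE => /orP[/(IHm _ (ltnW mt))|/andP[_ /exists_inP[y /(IHm _ (ltnW mt)) h xy]]].
  by apply: trip_widen => //; lia.
by apply: trip0_cat (trip_step xy) _; rewrite subnSK.
Qed.

Lemma reach_from_sub s v m : v \in D -> reach_from s v m \subset D.
Proof.
move=> vD; elim: m => [|m IHm] /=; first by rewrite sub1set.
by rewrite subUset IHm; apply/subsetP => y; rewrite inE => /andP[].
Qed.

Lemma reach_to_sub t v m : v \in D -> reach_to t v m \subset D.
Proof.
move=> vD; elim: m => [|m IHm] /=; first by rewrite sub1set.
by rewrite subUset IHm; apply/subsetP => y; rewrite inE => /andP[].
Qed.

Lemma reach_from_refl s v m : v \in reach_from s v m.
Proof. by elim: m => [|m IHm] /=; rewrite !inE ?IHm. Qed.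

Lemma reach_to_refl t v m : v \in reach_to t v m.
Proof. by elim: m => [|m IHm] /=; rewrite !inE ?IHm. Qed.

(* The forward set and the backward set each grow at most #|D| - 1 times, so
   they are simultaneously stable at some step of a window of length 2 #|D|. *)
Lemma reach_stable s v w : v \in D -> 2 * #|D| <= w ->
  exists2 m, m < w &
    reach_from s v m.+1 = reach_from s v m /\
    reach_to (s + w) v (w - m) = reach_to (s + w) v (w - m.+1).
Proof.
move=> vD Dw; set Q := reach_from s v; set P := reach_to (s + w) v.
case: (boolP [exists m : 'I_w, (Q m.+1 == Q m) && (P (w - m) == P (w - m.+1))]).
  by move=> /existsP[m /andP[/eqP Qm /eqP Pm]]; exists m.
rewrite negb_exists => /forallP nst; exfalso.
have grow m : m <= w -> #|Q 0| + #|P (w - m)| + m <= #|Q m| + #|P w|.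
  elim: m => [|m IHm] mw; first by rewrite subn0 addn0.
  have QS : Q m \subset Q m.+1 by exact: finset.subsetUl.
  have PS : P (w - m.+1) \subset P (w - m).
    by rewrite -[in X in _ \subset P X](subnSK mw); exact: finset.subsetUl.
  have := IHm (ltnW mw); have := nst (Ordinal mw); rewrite negb_and /=.
  have := subset_leq_card QS; have := subset_leq_card PS.
  have := subset_leqif_cards QS; have := subset_leqif_cards PS.
  rewrite [Q m.+1 == _]eq_sym [P (w - m) == _]eq_sym.
  by move=> [_ <-] [_ <-]; lia.
have := grow w (leqnn w); rewrite subnn.
have := subset_leq_card (reach_from_sub s w vD).
have := subset_leq_card (reach_to_sub (s + w) w vD).
rewrite -/P -/Q /= /P /Q /= !cards1; lia.
Qed.

End Trips.

(** * Pieces of the underlying graph and their hubs on the boundary *)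

Definition piece (V : finType) (U : rel V) (D B : {set V}) : Prop :=
  B \subset D /\ forall x y, x \in D -> x \notin B -> U x y -> y \in D.

Lemma connected_closed (V : finType) (G : sgraph V) (Z : {set V}) x :
  connected_graph G -> x \in Z ->
  (forall y z, y \in Z -> G y z -> z \in Z) -> forall y, y \in Z.
Proof.
move=> [_ cG] xZ cl y.
have /connectP[p] := cG x y (in_setT x) (in_setT y).
elim: p x xZ {cG} => [|z p IHp] x xZ /=; first by move=> _ ->.
by move=> /andP[/and3P[_ _ xz]] /IHp; apply; apply: cl xz.
Qed.

Section Hubs.

Variables (V : finType) (H : nat -> sgraph V) (U : rel V).
Hypothesis H_conn : forall t, connected_graph (H t).
Hypothesis H_sub : forall t x y, H t x y -> U x y.

Lemma piece_hub D B b0 s v w :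
  piece U D B -> b0 \in B -> v \in D -> 2 * #|D| <= w ->
  exists2 b, b \in B & trip H finset.set0 s (s + w) v b /\
    trip H finset.set0 s (s + w) b v.
Proof.
move=> [BD pDB] b0B vD Dw.
have [m mw [Qm Pm]] := reach_stable H s vD Dw.
set Q := reach_from H D s v m in Qm.
set P := reach_to H D (s + w) v (w - m.+1) in Pm.
have [/existsP[b /and3P[bB bQ bP]]|] := boolP [exists b, [&& b \in B, b \in Q & b \in P]].
  exists b => //; split.
    by apply: trip_widen (reach_from_trip bQ); lia.
  by apply: trip_widen (reach_to_trip _ bP); lia.
rewrite negb_exists => /forallP nB.
(* If [Q :&: P] misses [B], its neighbours in the snapshot [s + m] stay in [D], and stability
   absorbs them into both sets. Connectivity then puts [b0] itself into [Q :&: P]. *)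
have allZ := @connected_closed V (H (s + m)) (Q :&: P) v (H_conn _).
have := nB b0; rewrite b0B /= => /negP[]; rewrite -in_setI; apply: allZ.
  by rewrite inE /Q /P reach_from_refl reach_to_refl.
move=> y z; rewrite !inE => /andP[yQ yP] yz.
have yD : y \in D by apply: (subsetP (reach_from_sub H s m vD)).
have zD : z \in D.
  apply: (pDB y) => //; last exact: H_sub yz.
  by have := nB y; rewrite yQ yP !andbT.
apply/andP; split.
  by rewrite -Qm /= !inE zD orbC; apply/orP; left; apply/exists_inP; exists y.
rewrite -Pm -subnSK//= !inE zD orbC; apply/orP; left.
apply/exists_inP; exists y => //.
by rewrite subnSK// adj_sym; have -> : s + w - (w - m) = s + m by lia.
Qed.

End Hubs.

Lemma ord_pigeonhole (T : finType) (S : {set T}) M (f : 'I_M -> T) :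
  (forall i, f i \in S) -> #|S| < M -> exists i j : 'I_M, i < j /\ f i = f j.
Proof.
move=> fS SM; have /injectivePn[i [j ij fij]] : ~~ injectiveb f.
  apply/negP => /injectiveP f_inj; move: SM; rewrite ltnNge => /negP[].
  rewrite -{1}(card_ord M) -cardsT -(card_imset _ f_inj); apply: subset_leq_card.
  by apply/subsetP => _ /imsetP[i _ ->].
by case: (ltngtP i j) => [lt|lt|/val_inj eq]; [exists i, j|exists j, i|rewrite eq eqxx in ij].
Qed.

Lemma cardsU_sep (T : finType) (A A' E : {set T}) :
  A \subset ~: E -> A' \subset E -> #|A :|: A'| = #|A| + #|A'|.
Proof.
move=> AE A'E; apply/eqP; have [_ ->] := leq_card_setU A A'.
rewrite disjoints_subset.
by apply: subset_trans AE _; rewrite setCS.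
Qed.

(** * Tours from a home, and roaming agents *)

Section Exploration.

Variables (V : finType) (H : nat -> sgraph V) (U : rel V).
Hypothesis H_conn : forall t, connected_graph (H t).
Hypothesis H_sub : forall t x y, H t x y -> U x y.

(** [A] stands for the vertices still to be visited, and the home [b] may depend on [A] and on [s].
    Returning to [b] lets tours with the same home follow one another. *)
Definition homed (B D : {set V}) (tau F : nat) : Prop :=
  forall (A : {set V}) s, A \subset D -> exists2 b, b \in B &
    exists A' : {set V},
      [/\ A' \subset A, #|A| <= F * #|A'| & trip H A' s (s + tau) b b].

Lemma homed1 v : homed [set v] [set v] 0 1.
Proof.
move=> A s sA; exists v; first exact: set11.
exists A; split; rewrite ?mul1n//.
by apply: trip_sub sA (trip_wait _ _ _); rewrite addn0.
Qed.

Lemma homed_leq B D tau tau' F F' :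
  tau <= tau' -> F <= F' -> homed B D tau F -> homed B D tau' F'.
Proof.
move=> tt FF h A s sA; have [b bB [A' [A'A AA' tA']]] := h A s sA.
exists b => //; exists A'; split => //.
  by apply: leq_trans AA' _; rewrite leq_mul2r FF orbT.
by apply: trip_widen tA'; rewrite ?leq_add2l.
Qed.

(* In each of #|B'| * #|B| + 1 consecutive windows some home c in B' is good for
   D', and c is linked in both directions to some b in B. A repeated pair (c, b)
   gives the tour: b to c and the tour from c in the earlier window, back to b
   in the later one. *)
Lemma homed_lift (D B B' D' : {set V}) b0 g F :
  piece U D B -> b0 \in B -> B' \subset D -> homed B' D' g F ->
  homed B D' ((#|B'| * #|B|).+1 * (2 * #|D| + g)) F.
Proof.
move=> pDB b0B B'D hB' A s sA.
set w := 2 * #|D|; set l := w + g; set M := (#|B'| * #|B|).+1.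
have win (j : 'I_M) : exists u : (V * V) * {set V},
    [/\ u.1 \in setX B' B, u.2 \subset A, #|A| <= F * #|u.2|,
        trip H u.2 (s + j * l + w) (s + j * l + l) u.1.1 u.1.1 &
        trip H finset.set0 (s + j * l) (s + j * l + w) u.1.1 u.1.2 /\
        trip H finset.set0 (s + j * l) (s + j * l + w) u.1.2 u.1.1].
  have [c cB' [A' [A'A AA' tA']]] := hB' A (s + j * l + w) sA.
  have [b bB [cb bc]] := piece_hub H_conn H_sub (s + j * l) pDB b0B
    (subsetP B'D _ cB') (leqnn w).
  exists ((c, b), A'); split => //=; first by rewrite in_setX /= cB' bB.
  by rewrite [X in trip _ _ _ X]addnA.
have [u uP] := fin_all_exists win.
have [i [j [ij uij]]] : exists i j : 'I_M, i < j /\ (u i).1 = (u j).1.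
  apply: (@ord_pigeonhole _ (setX B' B)) => [i|]; last by rewrite cardsX.
  by have [] := uP i.
have [] := uP i; have [] := uP j; rewrite -uij.
case: (u i) => [[c b] A'] /= _ _ _ _ [cb _].
rewrite in_setX => /andP[/= _ bB] A'A AA' tA' [_ bc].
exists b => //; exists A'; split => //.
have ilj : i * l + l <= j * l by rewrite -mulSnr leq_mul2r ij orbT.
have jlM : j * l + l <= M * l by rewrite -mulSnr leq_mul2r ltn_ord orbT.
apply: (@trip_widen _ _ _ (s + i * l) _ (s + j * l + w)); [lia|lia|].
apply: trip0_cat bc _; apply: trip_cat0 cb.
by apply: trip_widen tA'; lia.
Qed.

Lemma homed_bigcup (B : {set V}) b0 (L : seq {set V}) tau F : b0 \in B ->
  (forall D, D \in L -> homed B D tau F) ->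
  homed B (\bigcup_(D <- L) D) (size L * tau) (#|B| * F).
Proof.
move=> b0B hL A s sA.
(* [f b] is what an agent based at [b] collects: it joins the tours with home [b] and waits during
   the others. The best [b] gets at least a fraction [1 / #|B|] of the sum. *)
have {sA} [f fP leF] : exists2 f : V -> {set V},
    forall b, b \in B -> f b \subset A /\ trip H (f b) s (s + size L * tau) b b &
    #|A| <= F * \sum_(b in B) #|f b|.
  elim: L hL A s sA => [|D L IHL] hL A s.
    rewrite big_nil subset0 => /eqP ->; exists (fun=> finset.set0).
      by move=> b _; rewrite sub0set; split => //; apply: trip0_wait; lia.
    by rewrite cards0.
  rewrite big_cons; set E := \bigcup_(D <- L) D => sA.
  (* The first part is asked only for [A :\: E] and the rest for [A :&: E], so that the gains are
     disjoint and add up. *)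
  have [D' D'L|f fP leF] := IHL _ (A :&: E) (s + tau) (subsetIr _ _).
    by apply: hL; rewrite inE D'L orbT.
  have sAD : A :\: E \subset D.
    apply/subsetP => x; rewrite inE => /andP[xE xA].
    by have := subsetP sA x xA; rewrite inE (negbTE xE) orbF.
  have [c cB [A' [A'A AA' tA']]] := hL D (mem_head _ _) (A :\: E) s sAD.
  exists (fun b => if b == c then A' :|: f b else f b).
    move=> b bB; have [fA tf] := fP b bB; rewrite /= mulSn addnA.
    case: eqP => [->|_]; split.
    - rewrite subUset (subset_trans A'A (subsetDl _ _)) /=.
      by have [fcA _] := fP c cB; exact: subset_trans fcA (subsetIl _ _).
    - by have [_ tfc] := fP c cB; exact: trip_cat tA' tfc.
    - exact: subset_trans fA (subsetIl _ _).
    - by apply: trip0_cat tf; apply: trip0_wait; lia.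
  rewrite -(cardsID E A) (bigD1 c)//= eqxx.
  rewrite (bigD1 c)//= in leF.
  under eq_bigr => b /andP[_ /negbTE bc] do rewrite bc.
  have [fcA _] := fP c cB; rewrite (@cardsU_sep _ _ _ E); first last.
  - exact: subset_trans fcA (subsetIr _ _).
  - by apply: subset_trans A'A _; rewrite setDE subsetIr.
  by move: leF AA'; rewrite !mulnDr; lia.
pose c := [arg max_(b > b0 in B) #|f b|].
have [cB cmax] : c \in B /\ forall b, b \in B -> #|f b| <= #|f c|.
  by rewrite /c; case: arg_maxnP => // i iB imax; split => // b /imax.
have [fcA tfc] := fP c cB.
exists c => //; exists (f c); split => //.
apply: leq_trans leF _; rewrite mulnAC mulnC leq_mul2r; apply/orP; right.
by rewrite -sum_nat_const leq_sum.
Qed.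

(** For the outermost level: the start is prescribed and the end is free, which costs [2 * #|V|]
    steps to reach a home. *)
Definition roaming (D : {set V}) (tau F : nat) : Prop :=
  forall (A : {set V}) s x, A \subset D -> exists y, exists A' : {set V},
      [/\ A' \subset A, #|A| <= F * #|A'| & trip H A' s (s + tau) x y].

(** With boundary [[set y]] the whole vertex set is a piece whose only possible hub is [y]. *)
Lemma trip_anywhere s x y : trip H finset.set0 s (s + 2 * #|V|) x y.
Proof.
have pT : piece U [set: V] [set y] by split => [|a b]; rewrite ?subsetT ?inE.
have [|b] := piece_hub H_conn H_sub s pT (set11 y) (in_setT x) (w := 2 * #|V|).
  by rewrite cardsT.
by rewrite inE => /eqP -> [].
Qed.

Lemma homed_roaming B D tau F : homed B D tau F -> roaming D (2 * #|V| + tau) F.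
Proof.
move=> h A s x sA; have [b bB [A' [A'A AA' tA']]] := h A (s + 2 * #|V|) sA.
exists b, A'; split => //; rewrite addnA.
exact: trip0_cat (trip_anywhere s x b) tA'.
Qed.

Lemma roaming1 v : roaming [set v] (2 * #|V|) 1.
Proof. by have := homed_roaming (@homed1 v); rewrite addn0. Qed.

Lemma roaming_leq D tau tau' F F' :
  tau <= tau' -> F <= F' -> roaming D tau F -> roaming D tau' F'.
Proof.
move=> tt FF h A s x sA; have [y [A' [A'A AA' tA']]] := h A s x sA.
exists y, A'; split => //.
  by apply: leq_trans AA' _; rewrite leq_mul2r FF orbT.
by apply: trip_widen tA'; rewrite ?leq_add2l.
Qed.

Lemma roaming_bigcup (L : seq {set V}) tau F :
  (forall D, D \in L -> roaming D tau F) ->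
  roaming (\bigcup_(D <- L) D) (size L * tau) F.
Proof.
elim: L => [|D L IHL] hL A s x.
  rewrite big_nil subset0 => /eqP ->; exists x, finset.set0.
  by rewrite sub0set cards0; split => //; apply: trip0_wait; lia.
rewrite big_cons; set E := \bigcup_(D <- L) D => sA.
have sAD : A :\: E \subset D.
  apply/subsetP => z; rewrite inE => /andP[zE zA].
  by have := subsetP sA z zA; rewrite inE (negbTE zE) orbF.
have [y [A' [A'A AA' tA']]] := hL D (mem_head _ _) (A :\: E) s x sAD.
have [D' D'L|z [A'' [A''A AA'' tA'']]] :=
    IHL _ (A :&: E) (s + tau) y (subsetIr _ _).
  by apply: hL; rewrite inE D'L orbT.
exists z, (A' :|: A''); split; last first.
- by rewrite /= mulSn addnA; exact: trip_cat tA' tA''.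
- rewrite (@cardsU_sep _ _ _ E); first last.
  + exact: subset_trans A''A (subsetIr _ _).
  + by apply: subset_trans A'A _; rewrite setDE subsetIr.
  by rewrite -(cardsID E A) mulnDr; lia.
- rewrite subUset (subset_trans A'A (subsetDl _ _)) /=.
  exact: subset_trans A''A (subsetIl _ _).
Qed.

(** While less than half of [A] is visited, more than half remains, so a round gains at least
    [#|A| / (2 F)]; hence [F] rounds suffice. *)
Lemma roaming_half D tau F : roaming D tau F -> roaming D (F * tau) 2.
Proof.
move=> h A s x sA.
have rounds j : exists y, exists A' : {set V},
    [/\ A' \subset A, trip H A' s (s + j * tau) x y &
     (#|A| <= 2 * #|A'|) || (j * #|A| <= 2 * F * #|A'|)].
  elim: j => [|j [y [A' [A'A tA' leA]]]].
    exists x, finset.set0; split; rewrite ?sub0set ?orbT//.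
    by apply: trip0_wait; lia.
  have [le2|lt2] := leqP #|A| (2 * #|A'|).
    by exists y, A'; rewrite le2; split => //; apply: trip_widen tA'; lia.
  have [z [A'' [A''A AA'' tA'']]] :=
    h (A :\: A') (s + j * tau) y (subset_trans (subsetDl _ _) sA).
  exists z, (A' :|: A''); split.
  - by rewrite subUset A'A (subset_trans A''A (subsetDl _ _)).
  - by rewrite mulSnr addnA; exact: trip_cat tA' tA''.
  - apply/orP; right; rewrite setUC (@cardsU_sep _ _ _ A')//; last first.
      by apply: subset_trans A''A _; rewrite setDE subsetIr.
    move: AA''; rewrite cardsD (setIidPr A'A).
    move: leA; rewrite leqNgt lt2 /= mulnDr => leA.
    by rewrite mulSnr -mulnA; lia.
have [y [A' [A'A tA' leA]]] := rounds F.
exists y, A'; split => //.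
case: F h {rounds} tA' leA => [h _ _|F _ _ /orP[//|]]; last first.
  by rewrite [2 * _]mulnC -mulnA leq_mul2l.
(* For [F = 0] no round takes place, but a factor 0 forces [A] to be empty. *)
by have [_ [B [_ + _]]] := h A 0 x sA; rewrite mul0n leqn0 => /eqP ->.
Qed.

Lemma roaming_all D tau m (A : {set V}) s x : roaming D tau 2 ->
  A \subset D -> #|A| < 2 ^ m -> exists y, trip H A s (s + m * tau) x y.
Proof.
move=> h; elim: m A s x => [|m IHm] A s x sA.
  rewrite expn0 ltnS leqn0 cards_eq0 => /eqP ->.
  by exists x; apply: trip0_wait; lia.
rewrite expnS => ltA; have [y [A' [A'A AA' tA']]] := h A s x sA.
have [||z tz] := IHm (A :\: A') (s + tau) y.
- exact: subset_trans (subsetDl _ _) sA.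
- by rewrite cardsD (setIidPr A'A); lia.
exists z; rewrite -(setID A A') (setIidPr A'A) mulSn addnA.
exact: trip_cat tA' tz.
Qed.

End Exploration.

(** * Trees with a node deleted, and maps sending each node to a neighbour *)

Section Trees.

Variables (N : finType) (T : sgraph N).

Definition avoiding (i : N) : rel N := [rel a b | [&& a != i, b != i & T a b]].

Lemma avoiding_sym i : connect_sym (avoiding i).
Proof.
by apply: sym_connect_sym => a b; rewrite /avoiding /= [T a b]adj_sym andbCA.
Qed.

(** [j] precedes the first occurrence of [i] on the path. The relation [r] serves both for the tree
    and for the tree without another node. *)
Lemma connect_avoiding (r : rel N) a i : subrel r T -> connect r a i -> a != i ->
  exists2 j, r j i & connect (avoiding i) a j.
Proof.
move=> rT /connectP[p]; elim: p a => [|b p IHp] a /=.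
  by move=> _ ->; rewrite eqxx.
move=> /andP[ab pp] ip ai; have [bi|bi] := eqVneq b i.
  by exists a; rewrite -?bi// connect0.
have [j ji bj] := IHp b pp ip bi; exists j => //.
by apply: connect_trans bj; apply: connect1; rewrite /avoiding /= ai bi rT.
Qed.

(** Otherwise a simple path from [j] to [m] avoiding [i] would close up through [i] to a cycle. *)
Lemma acyclic_avoiding i j m : acyclic_graph T ->
  T i j -> T i m -> connect (avoiding i) j m -> j = m.
Proof.
move=> acT ij im /connectP[q /shortenP[p pp up _] mE].
have Tp : path T j p by apply: sub_path pp => a b /and3P[].
have ip : i \notin p.
  elim: p j pp {up mE Tp ij} => //= b p IHp j /andP[/and3P[_ bi _] pp].
  by rewrite inE negb_or eq_sym bi (IHp b).
have /acT : ucycle T (i :: j :: p).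
  rewrite /ucycle /= ij rcons_path Tp -mE adj_sym im /= inE negb_or ip.
  by rewrite -/(uniq (j :: p)) up !andbT; apply: contraTneq ij => ->; rewrite adj_irr.
by case: p mE {pp up Tp ip}.
Qed.

(** A node of least order lies on its own [f]-cycle, for otherwise [f x] would have smaller order.
    In an acyclic graph this cycle has fewer than three nodes, and a fixed point would be a loop. *)
Lemma acyclic_turnback (f : N -> N) (x0 : N) : acyclic_graph T ->
  (forall x, T x (f x)) -> exists x, f (f x) = x.
Proof.
move=> acT Tf; pose x := [arg min_(y < x0) fingraph.order f y].
have /= xmin y : fingraph.order f x <= fingraph.order f y.
  by rewrite /x; case: arg_minnP => // i _; apply.
have cx : fcycle f (fingraph.orbit f x).
  case: orderPcycle => // _ ox; have := xmin (f x).
  by rewrite ox ltnn.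
have /acT : ucycle T (fingraph.orbit f x).
  rewrite /ucycle orbit_uniq andbT.
  by apply: sub_cycle cx => a b /eqP <-.
rewrite size_orbit => lt3; have /= := (orbitPcycle 0 4).1 cx.
case: (fingraph.order f x) (order_gt0 f x) lt3 => [|[|[|]]]// _ _ /= fx; last by exists x.
by have := Tf x; rewrite fx adj_irr.
Qed.

End Trees.

(** * Balanced bags and separators *)

Section BalancedBag.

Variables (V : finType) (G : sgraph V) (D : tree_decomposition G).

Lemma bag_connected (i : td_node D) v a b : v \notin td_bag i ->
  v \in td_bag a -> v \in td_bag b -> connect (avoiding (td_tree D) i) a b.
Proof.
move=> vi va vb.
have := @td_subtree _ _ D v a b; rewrite !inE => /(_ va vb).
apply: connect_sub => c d /and3P[]; rewrite !inE => vc vd cd.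
apply: connect1; rewrite /avoiding /= cd andbT.
by apply/andP; split; [apply: contraNneq vi => <-|apply: contraNneq vi => <-].
Qed.

(* Otherwise every node i points to the neighbour f i on its heavy side; two
   adjacent nodes pointing at each other would have disjoint heavy sides. *)
Lemma balanced_bag (nd : V -> td_node D) (w : V -> nat) :
  (forall v, v \in td_bag (nd v)) ->
  exists i : td_node D, forall l,
    2 * \sum_(v | (v \notin td_bag i) &&
                  (fingraph.root (avoiding (td_tree D) i) (nd v) == l)) w v
      <= \sum_v w v.
Proof.
move=> ndP; set W := \sum_v w v; set T := td_tree D.
pose side i l := [pred v | (v \notin td_bag i) && (fingraph.root (avoiding T i) (nd v) == l)].
case: (boolP [exists i, [forall l, 2 * \sum_(v | side i l v) w v <= W]]).
  by move=> /existsP[i /forallP h]; exists i.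
rewrite negb_exists => /forallP nbal; exfalso.
have [[N0 cT] acT] := td_treeP D; rewrite -/T in acT cT.
pose heavy i j := [pred v | (v \notin td_bag i) && connect (avoiding T i) (nd v) j].
have heavyP i : exists j, T i j /\ W < 2 * \sum_(v | heavy i j v) w v.
  have := nbal i; rewrite negb_forall => /existsP[l]; rewrite -ltnNge => lt.
  have /existsP[v /andP[vi /eqP vl]] : [exists v, side i l v].
    apply: contraT; rewrite negb_exists => /forallP no.
    by move: lt; rewrite big_pred0 ?muln0// => v; apply/negbTE/no.
  have ndi : nd v != i by apply: contraNneq vi => <-.
  have [||j ji vj] := @connect_avoiding _ T T (nd v) i _ _ ndi => //.
    have := cT (nd v) i; rewrite !inE => /(_ isT isT); apply: connect_sub => a b /=.
    by move=> /and3P[_ _ ab]; exact: connect1.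
  exists j; split; first by rewrite adj_sym.
  apply: leq_trans lt _; rewrite leq_mul2l /=; apply: eq_leq.
  apply: eq_bigl => u /=; rewrite -vl root_connect//; last exact: avoiding_sym.
  by rewrite (same_connect_r (avoiding_sym T i) vj).
have [f fP] := fin_all_exists heavyP.
have /card_gt0P[x0 _] := N0.
have [x fx] := acyclic_turnback x0 acT (fun x => proj1 (fP x)).
have [xy wx] := fP x; have [_ wy] := fP (f x); rewrite fx in wy.
set y := f x in xy wx wy.
have /existsP[v /andP[/andP[vx ndy] /andP[vy ndx]]] : [exists v, heavy x y v && heavy y x v].
  apply: contraT; rewrite negb_exists => /forallP no.
  have : \sum_(v | heavy x y v) w v + \sum_(v | heavy y x v) w v <= W.
    rewrite big_mkcond [X in _ + X]big_mkcond -big_split /=; apply: leq_sum => v _.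
    by have := no v => /=; case: ifP; case: ifP; rewrite ?addn0.
  by lia.
have nx : nd v != x by apply: contraNneq vx => <-.
(* A path from [nd v] to [x] avoiding [y] enters [x] through some [j]. At [x], both [j] and [y] lie
   on the side of [nd v], so acyclicity gives [j = y], a contradiction. *)
have [|j /and3P[jy _ jx] vj] := @connect_avoiding _ T (avoiding T y) _ _ _ ndx nx.
  by move=> a b /and3P[].
have := @acyclic_avoiding _ T x j y acT; rewrite [T x j]adj_sym jx xy => /(_ isT isT).
move=> jyE; move: jy; rewrite jyE ?eqxx//.
by rewrite avoiding_sym; apply: connect_trans vj; rewrite avoiding_sym.
Qed.

End BalancedBag.

(** Take [K] heaviest among the groups of weight at most 2W/3. If the complement exceeded 2W/3, [K]
    would weigh less than W/3; by maximality so would any [l] outside [K], and adding an [l] of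
    positive weight would give a heavier admissible group. *)
Lemma two_balanced_groups (L : finType) (w : L -> nat) W :
  (forall l, 2 * w l <= W) -> \sum_l w l <= W ->
  exists K : {set L}, 3 * \sum_(l in K) w l <= 2 * W /\
    3 * \sum_(l in ~: K) w l <= 2 * W.
Proof.
move=> wl wW; pose ok (K : {set L}) := 3 * \sum_(l in K) w l <= 2 * W.
have ok0 : ok finset.set0 by rewrite /ok big_set0 muln0.
have [K okK Kmax] := arg_maxnP (fun K : {set L} => \sum_(l in K) w l) ok0.
exists K; split=> //; rewrite leqNgt; apply/negP => ltC.
have split_sum : \sum_(l in K) w l + \sum_(l in ~: K) w l <= W.
  apply: leq_trans wW; rewrite [X in _ <= X](bigID (mem K)) /= leq_add2l.
  by apply: eq_leq; apply: eq_bigl => l; rewrite !inE.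
have /existsP[l /andP[lK wl0]] : [exists l, (l \in ~: K) && (0 < w l)].
  apply: contraT; rewrite negb_exists => /forallP no.
  move: ltC; rewrite big1 ?muln0// => l lK.
  by have := no l; rewrite lK /= lt0n negbK => /eqP.
rewrite inE in lK.
have := Kmax [set l]; rewrite /ok big_set1 => max1.
have := Kmax (l |: K); rewrite /ok big_setU1//= => max2.
have := wl l; move: okK; rewrite /ok.
have : 3 * w l <= 2 * W by have := wl l; lia.
move=> /max1 /=; case: (leqP (3 * (w l + \sum_(i in K) w i)) (2 * W)).
  by move=> /max2 /=; lia.
by lia.
Qed.

(** [Z] is a balanced bag together with [x0], which keeps all later boundaries nonempty; [A1] and
    [A2] group the components left by deleting the bag's node. Adjacent vertices outside the bag
    share another bag, hence a component. *)
Lemma separator (V : finType) (G : sgraph V) (D : tree_decomposition G) (x0 : V)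
    (w : V -> nat) :
  exists Z A1 A2 : {set V},
    [/\ x0 \in Z, #|Z| <= (td_width D).+2,
        [/\ [disjoint A1 & A2], [disjoint A1 & Z], [disjoint A2 & Z] &
            forall v, v \in A1 :|: A2 :|: Z],
        forall u v, u \in A1 -> v \in A2 -> ~~ G u v &
        3 * \sum_(v in A1) w v <= 2 * \sum_v w v /\
        3 * \sum_(v in A2) w v <= 2 * \sum_v w v].
Proof.
have [nd ndP] := fin_all_exists (@td_vertex _ _ D).
have [i ibal] := balanced_bag w ndP.
set W := \sum_v w v in ibal *.
pose cls v := fingraph.root (avoiding (td_tree D) i) (nd v).
have [] := two_balanced_groups ibal.
  rewrite -(partition_big cls predT)//=.
  by rewrite /W [X in _ <= X](bigID (fun v => v \notin td_bag i)) leq_addr.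
move=> K [K1 K2]; pose Z := x0 |: td_bag i.
have sumA (K' : {set td_node D}) :
    \sum_(v in [set v | (v \notin Z) && (cls v \in K')]) w v <=
    \sum_(l in K') \sum_(v | (v \notin td_bag i) && (cls v == l)) w v.
  have -> : \sum_(l in K') \sum_(v | (v \notin td_bag i) && (cls v == l)) w v =
      \sum_(v | (v \notin td_bag i) && (cls v \in K')) w v.
    rewrite [RHS](partition_big cls (mem K')) => [|v /andP[]//].
    apply: eq_bigr => l lK; apply: eq_bigl => v.
    by case: eqP => [->|]; rewrite ?lK ?andbT ?andbF.
  rewrite big_mkcond [X in _ <= X]big_mkcond; apply: leq_sum => v _.
  rewrite !inE negb_or; case: (v \notin td_bag i); rewrite ?andbF//=.
  by case: (cls v \in K'); rewrite ?andbF//=; case: ifP.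
exists Z, [set v | (v \notin Z) && (cls v \in K)],
  [set v | (v \notin Z) && (cls v \in ~: K)]; split.
- exact: setU11.
- rewrite cardsU1 /td_width.
  have : #|td_bag i| <= \max_(i : td_node D) #|td_bag i| by exact: leq_bigmax.
  by case: (x0 \notin _); lia.
- split.
  + rewrite -setI_eq0; apply/eqP/setP => v; rewrite !inE.
    by case: (cls v \in K); rewrite !andbF.
  + rewrite disjoints_subset; apply/subsetP => v.
    by rewrite inE => /andP[vZ _]; rewrite inE.
  + rewrite disjoints_subset; apply/subsetP => v.
    by rewrite inE => /andP[vZ _]; rewrite inE.
  + move=> v; rewrite in_setU orbC; have [//|vZ /=] := boolP (v \in Z).
    rewrite in_setU; have [cK|cK] := boolP (cls v \in K); apply/orP.
      by left; rewrite in_set vZ.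
    by right; rewrite in_set vZ in_setC.
- move=> u v; rewrite !inE !negb_or => /andP[/andP[_ ui] uK] /andP[/andP[_ vi] vK].
  apply: contra vK => /(@td_edge _ _ D)[a [ua va]].
  suff -> : cls v = cls u by [].
  apply/eqP; rewrite root_connect; last exact: avoiding_sym.
  apply: (@connect_trans _ _ a); first exact: bag_connected vi (ndP v) va.
  exact: bag_connected ui ua (ndP u).
- split; [apply: leq_trans K1|apply: leq_trans K2]; rewrite leq_mul2l; exact: sumA.
Qed.

(** * Cutting a piece into parts of bounded weight *)

Section Decomposition.

Variables (V : finType) (G : sgraph V) (T : tree_decomposition G).
Variables (kap m : nat) (x0 : V).
Hypothesis width_kap : (td_width T).+2 <= kap.

(* Charging the boundary vertices m extra units keeps both the size and the
   boundary of the parts under control with a single balanced separator. *)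
Definition weight (D B : {set V}) : nat := #|D| + m * #|B|.

Lemma sum_weight (D B S : {set V}) :
  \sum_(v in S) ((v \in D) + m * (v \in B)) = weight (D :&: S) (B :&: S).
Proof.
rewrite big_split -big_distrr /weight -!sum1_card /=; congr (_ + m * _).
  by rewrite -big_mkcondr /=; apply: eq_bigl => v; rewrite inE andbC.
by rewrite -big_mkcondr /=; apply: eq_bigl => v; rewrite inE andbC.
Qed.

Lemma cardsIU_disjoint (D A Z : {set V}) : [disjoint A & Z] ->
  #|D :&: (A :|: Z)| = #|D :&: A| + #|D :&: Z|.
Proof.
rewrite disjoints_subset => AZ; rewrite setIUr (@cardsU_sep _ _ _ Z) ?subsetIr//.
exact: subset_trans (subsetIr _ _) AZ.
Qed.

(** On each side the vertices of [D :&: Z] join the boundary, each weighing [m.+1]. *)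
Lemma piece_side (D B Z A : {set V}) : piece G D B -> x0 \in B -> x0 \in Z ->
  [disjoint A & Z] -> (forall u v, u \in A -> G u v -> v \in A :|: Z) ->
  let D' := D :&: (A :|: Z) in let B' := (B :&: A) :|: (D :&: Z) in
  [/\ piece G D' B', x0 \in B' &
      weight D' B' = weight (D :&: A) (B :&: A) + m.+1 * #|D :&: Z|].
Proof.
move=> [BD pDB] x0B x0Z AZ clA D' B'; split.
- split=> [|x y].
    rewrite subUset; apply/andP; split; last by rewrite setIS// subsetUr.
    exact: subset_trans (setSI _ BD) (setIS _ (subsetUl _ _)).
  rewrite !inE => /andP[xD xAZ]; rewrite xD /= negb_or => /andP[xB xZ] xy.
  move: xAZ; rewrite (negbTE xZ) orbF => xA; rewrite xA andbT in xB.
  by rewrite (pDB x)//=; have := clA x y xA xy; rewrite inE.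
- by rewrite !inE x0Z (subsetP BD _ x0B) orbT.
- rewrite /weight /B' cardsIU_disjoint// (@cardsU_sep _ _ _ Z) ?subsetIr//; first lia.
  by apply: subset_trans (subsetIr _ _) _; rewrite -disjoints_subset.
Qed.

Definition parts_of (D : {set V}) (L : seq ({set V} * {set V})) : Prop :=
  (forall q, q \in L -> [/\ piece G q.1 q.2, x0 \in q.2, q.1 \subset D &
     weight q.1 q.2 <= 12 * (m.+1 * kap)]) /\
  D \subset \bigcup_(q <- L) q.1.

Lemma parts_cat (D D1 D2 : {set V}) L1 L2 : D1 \subset D -> D2 \subset D ->
  D \subset D1 :|: D2 -> parts_of D1 L1 -> parts_of D2 L2 ->
  parts_of D (L1 ++ L2).
Proof.
move=> D1D D2D DD [L1P D1L] [L2P D2L]; split.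
  by move=> q; rewrite mem_cat => /orP[/L1P|/L2P] [p x sq wq]; split => //;
     exact: subset_trans sq _.
by rewrite big_cat; apply: subset_trans DD _; exact: setUSS.
Qed.

(** With [e = m.+1 * kap], a cut of weight W > 12e yields sides of weight at least W/3 > 4e and at
    most 2W/3 + e < W, of total at most W + 2e. The successor in [(size L).+1] pays for the extra
    2e. *)
Lemma decomposition_heavy (D B : {set V}) : piece G D B -> x0 \in B ->
  4 * (m.+1 * kap) <= weight D B ->
  exists2 L, parts_of D L & 2 * (m.+1 * kap) * (size L).+1 <= weight D B.
Proof.
set e := m.+1 * kap; have [n] := ubnP (weight D B).
elim: n D B => // n IHn D B; rewrite ltnS => Wn pDB x0B W4.
have [W12|W12] := leqP (weight D B) (12 * e).
  exists [:: (D, B)]; last by rewrite /=; lia.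
  split; last by rewrite big_seq1.
  by move=> q; rewrite inE => /eqP -> /=.
have [Z [A1 [A2 [x0Z Zk [A12 A1Z A2Z cov] nG [w1 w2]]]]] :=
  separator T x0 (fun v => (v \in D) + m * (v \in B)).
have clA1 u v : u \in A1 -> G u v -> v \in A1 :|: Z.
  move=> uA1 uv; have := cov v; rewrite !inE -orbA => /or3P[->//|vA2|->]; rewrite ?orbT//.
  by have := nG u v uA1 vA2; rewrite uv.
have clA2 u v : u \in A2 -> G u v -> v \in A2 :|: Z.
  move=> uA2 uv; have := cov v; rewrite !inE -orbA => /or3P[vA1|->|->]; rewrite ?orbT//.
  by have := nG v u vA1 uA2; rewrite adj_sym uv.
have [p1 x1 W1] := piece_side pDB x0B x0Z A1Z clA1.
have [p2 x2 W2] := piece_side pDB x0B x0Z A2Z clA2.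
have sumW : \sum_v ((v \in D) + m * (v \in B)) = weight D B.
  by rewrite -[D in RHS]setIT -[B in RHS]setIT -sum_weight; apply: eq_bigl => v; rewrite inE.
rewrite !sum_weight sumW in w1 w2.
have Ze : m.+1 * #|D :&: Z| <= e.
  rewrite leq_mul2l /=; apply: leq_trans (leq_trans Zk width_kap).
  exact: subset_leq_card (subsetIr _ _).
have cov3 (E : {set V}) : #|E| = #|E :&: A1| + #|E :&: A2| + #|E :&: Z|.
  rewrite -cardsIU_disjoint// -cardsIU_disjoint.
    by congr #|pred_of_set _|; apply/setP => v; rewrite in_setI cov andbT.
  by rewrite disjoints_subset subUset -!disjoints_subset A1Z.
have BZ : #|B :&: Z| <= #|D :&: Z| by apply: subset_leq_card; apply: setSI; case: pDB.
have sumW3 : weight D B <= weight (D :&: A1) (B :&: A1) +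
    weight (D :&: A2) (B :&: A2) + m.+1 * #|D :&: Z|.
  rewrite /weight (cov3 D) (cov3 B) !mulnDr mulSn.
  have : m * #|B :&: Z| <= m * #|D :&: Z| by rewrite leq_mul2l BZ orbT.
  by lia.
have sumW12 : weight (D :&: A1) (B :&: A1) + weight (D :&: A2) (B :&: A2) <= weight D B.
  by rewrite /weight (cov3 D) (cov3 B) !mulnDr; lia.
have [||L1 L1P sL1] := IHn _ _ _ p1 x1; [lia|lia|].
have [||L2 L2P sL2] := IHn _ _ _ p2 x2; [lia|lia|].
exists (L1 ++ L2).
  apply: parts_cat L1P L2P; rewrite ?subsetIl//.
  apply/subsetP => v vD; have := cov v; rewrite !inE vD /=.
  by move=> /orP[/orP[]|] ->; rewrite ?orbT.
by rewrite size_cat -addnS; nia.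
Qed.

Lemma decomposition (D B : {set V}) : piece G D B -> x0 \in B ->
  exists2 L, parts_of D L & size L * (m.+1 * kap) <= weight D B + m.+1 * kap.
Proof.
move=> pDB x0B; have [W4|W4] := leqP (4 * (m.+1 * kap)) (weight D B).
  have [L LP sL] := decomposition_heavy pDB x0B W4.
  by exists L => //; nia.
exists [:: (D, B)]; last by rewrite /=; lia.
split; last by rewrite big_seq1.
by move=> q; rewrite inE => /eqP -> /=; split => //; lia.
Qed.

End Decomposition.

(** * The three levels of pieces and their tour times *)

Section Levels.

Variables (V : finType) (H : nat -> sgraph V) (G : sgraph V).
Hypothesis H_conn : forall t, connected_graph (H t).
Hypothesis H_sub : forall t x y, H t x y -> G x y.

(** Lowest level: each vertex, as its own home with a tour of length 0, is lifted to [B] and gets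
    its own stretch of time. *)
Lemma homed_piece (D B : {set V}) b0 : piece G D B -> b0 \in B ->
  homed H B D (#|D| * (#|B|.+1 * (2 * #|D|))) #|B|.
Proof.
move=> pDB b0B; pose L := [seq [set v] | v <- enum D].
have DL : D = \bigcup_(E <- L) E.
  rewrite big_map big_enum; apply/setP => x; apply/idP/bigcupP.
    by move=> xD; exists x; rewrite ?set11.
  by move=> [v vD]; rewrite inE => /eqP ->.
have -> : #|D| * (#|B|.+1 * (2 * #|D|)) = size L * (#|B|.+1 * (2 * #|D|)).
  by rewrite size_map -cardE.
rewrite [X in homed _ _ X]DL -[X in homed _ _ _ _ X]muln1.
apply: (homed_bigcup b0B) => _ /mapP[v + ->]; rewrite mem_enum => vD.
have := homed_lift H_conn H_sub pDB b0B _ (@homed1 _ H v); rewrite cards1 mul1n addn0.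
by apply; rewrite sub1set.
Qed.

Variables (T : tree_decomposition G) (kap : nat).
Hypothesis width_kap : (td_width T).+2 <= kap.

Lemma weight_bounds m (D B : {set V}) : piece G D B ->
  weight m D B <= 12 * (m.+1 * kap) -> #|D| <= 12 * (m.+1 * kap) /\ #|B| <= 12 * kap.
Proof.
rewrite /weight => -[/subset_leq_card BD _] W; split; first lia.
suff : m.+1 * #|B| <= m.+1 * (12 * kap) by rewrite leq_mul2l.
by move: BD W; rewrite mulSn mulnCA; lia.
Qed.

(** Middle level: a piece of scale [m.+1 ^ 2] is cut at scale [m.+1]. There are at most [25 * m.+1]
    parts; 145 is 12 * 12 + 1 for the repeated windows, and 3768 is 24 + 12 * 13 * 24 for a window
    plus the tour of a part. *)
Lemma homed_parts m m' (D B : {set V}) x0 : m'.+1 = m.+1 ^ 2 ->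
  piece G D B -> x0 \in B -> weight m' D B <= 12 * (m'.+1 * kap) ->
  let rho := m.+1 * kap in
  homed H B D (25 * m.+1 * (145 * kap ^ 2 * (3768 * rho ^ 2 * kap)))
    (144 * kap ^ 2).
Proof.
move=> mm' pDB x0B W rho; have [cD cB] := weight_bounds pDB W.
have kap0 : 0 < kap by apply: leq_trans width_kap.
have [L [LP DL] sL] := decomposition m width_kap pDB x0B.
have {}sL : size L <= 25 * m.+1.
  rewrite -(leq_pmul2r kap0) -(leq_pmul2r (ltn0Sn m)).
  move: sL cD cB; rewrite /weight mm'; nia.
have cD' : 2 * #|D| <= 24 * rho ^ 2 * kap.
  by move: cD; rewrite mm' /rho; nia.
apply: (@homed_leq _ _ _ _
  (size [seq q.1 | q <- L] * (145 * kap ^ 2 * (3768 * rho ^ 2 * kap))) _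
  (#|B| * (12 * kap))).
- by rewrite size_map leq_mul2r sL orbT.
- by move: cB; nia.
suff : homed H B (\bigcup_(E <- [seq q.1 | q <- L]) E)
    (size [seq q.1 | q <- L] * (145 * kap ^ 2 * (3768 * rho ^ 2 * kap)))
    (#|B| * (12 * kap)).
  move=> h A s sA; apply: h; rewrite big_map; exact: subset_trans sA DL.
apply: (homed_bigcup x0B) => _ /mapP[q qL ->].
have [pq xq qD Wq] := LP q qL; have [cq1 cq2] := weight_bounds pq Wq.
have q2D : q.2 \subset D by apply: subset_trans qD; case: pq.
apply: homed_leq (homed_lift H_conn H_sub pDB x0B q2D (homed_piece pq xq)) => //.
rewrite -/rho in cq1; apply: leq_mul.
  have : #|q.2| * #|B| <= (12 * kap) * (12 * kap) by apply: leq_mul.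
  by nia.
have : #|q.1| * (#|q.2|.+1 * (2 * #|q.1|)) <= (12 * rho) * ((13 * kap) * (24 * rho)).
  by apply: leq_mul => //; apply: leq_mul; lia.
by nia.
Qed.

(** Top level: all of [V], with boundary [[set x0]], is cut at scale [m.+1 ^ 2]. The part count
    comes from [m.+1 ^ 2 * kap * (kap * rho) = rho ^ 3]. *)
Lemma roaming_parts m (x0 : V) : let rho := m.+1 * kap in #|V| <= 8 * rho ^ 3 ->
  roaming H [set: V] (10 * kap * rho * (2 * #|V| +
    25 * m.+1 * (145 * kap ^ 2 * (3768 * rho ^ 2 * kap)))) (144 * kap ^ 2).
Proof.
move=> rho nrho; pose m' := (m.+1 ^ 2).-1.
have mm' : m'.+1 = m.+1 ^ 2 by rewrite prednK// expn_gt0.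
have kap0 : 0 < kap by apply: leq_trans width_kap.
have pT : piece G [set: V] [set x0] by split=> [|x y]; rewrite ?subsetT ?inE.
have [L [LP TL] sL] := decomposition m' width_kap pT (set11 x0).
have {}sL : size L <= 10 * kap * rho.
  have rho0 : 0 < m.+1 * rho by rewrite !muln_gt0 kap0.
  rewrite -(leq_pmul2r rho0).
  have -> : m.+1 * rho = m'.+1 * kap by rewrite mm' /rho; lia.
  apply: leq_trans sL _; rewrite /weight cardsT cards1 muln1.
  have e1 : 10 * kap * rho * (m'.+1 * kap) = 8 * rho ^ 3 + 2 * rho ^ 3.
    by rewrite mm' /rho; lia.
  rewrite e1; have : m'.+1 * kap <= rho ^ 3.
    rewrite mm' /rho expnMn; apply: leq_mul; first by rewrite leq_pexp2l.
    by rewrite -{1}[kap]expn1 leq_pexp2l.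
  by nia.
apply: (@roaming_leq _ _ _ (size [seq q.1 | q <- L] * (2 * #|V| +
    25 * m.+1 * (145 * kap ^ 2 * (3768 * rho ^ 2 * kap)))) _ (144 * kap ^ 2)) => //.
  by rewrite size_map leq_mul2r sL orbT.
suff h : roaming H (\bigcup_(E <- [seq q.1 | q <- L]) E)
    (size [seq q.1 | q <- L] * (2 * #|V| +
    25 * m.+1 * (145 * kap ^ 2 * (3768 * rho ^ 2 * kap)))) (144 * kap ^ 2).
  by move=> A s x sA; apply: h; rewrite big_map; exact: subset_trans sA TL.
apply: roaming_bigcup => _ /mapP[q qL ->].
have [pq xq qD Wq] := LP q qL.
apply: (homed_roaming H_conn H_sub (B := q.2)).
exact: homed_parts mm' pq xq Wq.
Qed.

Lemma roaming_naive : roaming H [set: V] (#|V| * (2 * #|V|)) 1.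
Proof.
have := @roaming_bigcup V H [seq [set v] | v <- enum V] (2 * #|V|) 1.
rewrite size_map -cardE => h.
suff : roaming H (\bigcup_(D <- [seq [set v] | v <- enum V]) D) (#|V| * (2 * #|V|)) 1.
  move=> {}h A s x _; apply: h; apply/subsetP => v _.
  by rewrite big_map big_enum; apply/bigcupP; exists v; rewrite ?set11.
apply: h => _ /mapP[v _ ->]; exact: roaming1 H_conn H_sub v.
Qed.

End Levels.

(** * Choice of the scale and the total time *)

Lemma cube_scale (kap n : nat) : 0 < kap -> kap ^ 3 <= n ->
  exists m, (m.+1 * kap) ^ 3 <= n <= 8 * (m.+1 * kap) ^ 3.
Proof.
move=> kap0 kn; pose P m := (m.+1 * kap) ^ 3 <= n.
have P0 : exists m, P m by exists 0; rewrite /P mul1n.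
have Pn m : P m -> m <= n.
  move=> Pm; apply: ltnW; apply: leq_trans Pm.
  by apply: leq_trans (leq_pmulr _ kap0) _; rewrite -{1}[_ * kap]expn1 leq_pexp2l// muln_gt0 kap0.
(* For the largest admissible [m], passing to [m.+2 <= 2 * m.+1] costs at most the factor 8. *)
have [m Pm mmax] := ex_maxnP P0 Pn; exists m; apply/andP; split => //.
rewrite leqNgt; apply/negP => lt; have := mmax m.+1; rewrite ltnn => /implyP.
rewrite implybF /P -ltnNge => lt2.
have : (m.+2 * kap) ^ 3 <= (2 * (m.+1 * kap)) ^ 3 by rewrite leq_exp2r//; lia.
by rewrite expnMn; lia.
Qed.

Theorem exploration_trip : exists c, forall (V : finType) (H : nat -> sgraph V)
    (G : sgraph V) (T : tree_decomposition G) (kap : nat),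
  (forall t, connected_graph (H t)) -> (forall t x y, H t x y -> G x y) ->
  (td_width T).+2 <= kap -> 0 < #|V| ->
  exists2 rho, rho ^ 3 <= #|V| & forall x, exists y,
    trip H [set: V] 0
      (c * ((trunc_log 2 #|V|).+1 * (kap ^ 5 * (rho * #|V|)))) x y.
Proof.
(* 1440 is 144 from the fraction visited per round times 10 from the part count; the other factor
   bounds the time per part over [#|V| * kap ^ 2]. *)
exists (1440 * (25 * (145 * 3768) + 2)) => V H G T kap H_conn H_sub wk V0.
have kap0 : 0 < kap by apply: leq_trans wk.
set m := (trunc_log 2 #|V|).+1.
have Vm : #|[set: V]| < 2 ^ m by rewrite cardsT; exact: trunc_log_ltn.
(* Below [kap ^ 3] vertices, visiting them one by one is fast enough: [#|V| ^ 2 <= kap ^ 5 * #|V|],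
   with [rho = 1]. *)
have [kV|Vk] := leqP (kap ^ 3) #|V|; last first.
  exists 1; first by rewrite exp1n.
  move=> x; have r2 : roaming H [set: V] (#|V| * (2 * #|V|)) 2.
    exact: roaming_leq (roaming_naive H_conn H_sub).
  have [y txy] := roaming_all 0 x r2 (subxx _) Vm.
  exists y; apply: trip_widen txy => //; rewrite add0n mul1n.
  rewrite [X in _ <= X]mulnCA leq_mul2l; apply/orP; right.
  rewrite mulnCA; apply: leq_mul.
    by apply: leq_trans (leq_pmull _ (ltn0Sn _)); exact: leq_addl.
  rewrite leq_mul2r; apply/orP; right.
  by apply: leq_trans (ltnW Vk) _; rewrite leq_pexp2l.
have [j /andP[jV Vj]] := cube_scale kap0 kV.
exists (j.+1 * kap) => // x.
have /roaming_half r2 := roaming_parts H_conn H_sub wk x Vj.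
have [y txy] := roaming_all 0 x r2 (subxx _) Vm.
exists y; apply: trip_widen txy => //; rewrite add0n.
move: jV; set rho := j.+1 * kap => jV.
rewrite [X in _ <= X]mulnCA leq_mul2l; apply/orP; right.
have -> : 25 * j.+1 * (145 * kap ^ 2 * (3768 * rho ^ 2 * kap)) =
    25 * (145 * 3768) * (rho ^ 3 * kap ^ 2).
  move: 25 145 3768 => a b d; rewrite /rho; lia.
move: (25 * (145 * 3768)) => a; rewrite -[1440]/(144 * 10).
move: 10 144 => d b.
have h1 : 2 * #|V| + a * (rho ^ 3 * kap ^ 2) <= (a + 2) * (#|V| * kap ^ 2).
  rewrite mulnDl addnC leq_add//.
    by rewrite leq_mul2l; apply/orP; right; rewrite leq_mul2r jV orbT.
  by rewrite leq_mul2l /= leq_pmulr// expn_gt0 kap0.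
apply: (@leq_trans (b * kap ^ 2 * (d * kap * rho * ((a + 2) * (#|V| * kap ^ 2))))).
  by rewrite !leq_mul2l h1 !orbT.
by apply: eq_leq; lia.
Qed.

(** * Turning lazy walks into temporal walks *)

Section Walks.

Variables (V : finType) (T : nat) (G : temporal_graph V T.+1).

(** Waiting leaves no step; [inord s] is the true time as long as [s <= T]. *)
Fixpoint walk_steps (s : nat) (x : V) (p : seq V) : seq (temporal_step V T.+1) :=
  if p is y :: p' then
    if x == y then walk_steps s.+1 y p'
    else ((x, y), inord s) :: walk_steps s.+1 y p'
  else [::].

Lemma walk_stepsP s x p : s + size p <= T.+1 ->
  lazy_walk (fun t => G (inord t)) s x p ->
  [/\ temporal_walk G x (walk_steps s x p),
      all (fun t => s <= t < s + size p) [seq val u.2 | u <- walk_steps s x p] &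
      {subset x :: p <= visited x (walk_steps s x p)}].
Proof.
elim: p s x => [|y p IHp] s x; first by split.
move=> /= sT /andP[xy wp].
rewrite addnS -addSn in sT *.
have [/and3P[wc wa ws] wt wv] := IHp _ _ sT wp.
have wt' : all (fun t => s < t < s.+1 + size p) [seq val u.2 | u <- walk_steps s.+1 y p].
  exact: wt.
have [xyE|nxy] := eqVneq x y.
  subst y; split; first by apply/and3P.
    by apply: sub_all wt' => t /andP[st ->]; rewrite ltnW.
  by move=> v; rewrite inE => /orP[/eqP ->|/wv//]; rewrite mem_head.
rewrite (negbTE nxy) /= in xy.
have sE : val (inord s : 'I_T.+1) = s.
  by rewrite /= inordK//; apply: leq_trans sT; rewrite addSn ltnS leq_addr.
split.
- rewrite /temporal_walk /= eqxx wc xy wa /= (path_sortedE ltn_trans) ws andbT.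
  rewrite inordK; last by apply: leq_trans sT; rewrite addSn ltnS leq_addr.
  by apply: sub_all wt' => t /andP[].
- rewrite /= -/(val _) sE leqnn addSn ltnS leq_addr /=.
  by apply: sub_all wt' => t /andP[st ->]; rewrite ltnW.
- move=> v; rewrite inE => /orP[/eqP ->|/wv vw]; first exact: mem_head.
  by rewrite /visited /= inE; apply/orP; right; exact: vw.
Qed.

End Walks.

Lemma treewidth_decomposition (V : finType) (G : sgraph V) :
  exists D : tree_decomposition G, td_width D = treewidth G.
Proof. by rewrite /treewidth; case: ex_minnP => w /asboolP. Qed.

Local Open Scope ring_scope.

(** * Comparison with the real-valued bound *)

Section RealBounds.

Variable R : realType.

Lemma ln_nat_ge (n : nat) : (2 <= n)%N -> ln 2 <= ln n%:R :> R.
Proof. by move=> n2; rewrite ler_ln ?posrE ?ler_nat ?ltr0n//; lia. Qed.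

Lemma trunc_log_le_ln (n : nat) : (2 <= n)%N ->
  (trunc_log 2 n).+1%:R <= 2 / ln 2 * ln n%:R :> R.
Proof.
move=> n2; have l2 : 0 < ln 2 :> R by rewrite ln_gt0// ltr1n.
rewrite mulrAC ler_pdivlMr// -addn1 natrD mulrDl mul1r.
have h : (trunc_log 2 n)%:R * ln 2 <= ln n%:R :> R.
  rewrite mulr_natl -lnXn ?ltr0n// ler_ln ?posrE ?exprn_gt0 ?ltr0n//; last lia.
  by rewrite -natrX ler_nat trunc_logP//; lia.
by apply: le_trans (lerD h (ln_nat_ge n2)) _; rewrite mulr_natl mulr2n.
Qed.

(** The surplus power 3/2 of the logarithm is at least that of [ln 2]. *)
Lemma ln_le_powR (n : nat) : (2 <= n)%N ->
  ln n%:R <= ln n%:R `^ (5 / 2) / ln 2 `^ (3 / 2) :> R.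
Proof.
move=> n2; have l2 : 0 < ln 2 :> R by rewrite ln_gt0// ltr1n.
have ln0 : 0 < ln n%:R :> R by apply: lt_le_trans l2 (ln_nat_ge n2).
rewrite ler_pdivlMr ?powR_gt0//.
have -> : 5 / 2 = 1 + 3 / 2 :> R by lra.
rewrite powRD; last by rewrite gt_eqF// addr_gt0// divr_gt0.
rewrite powRr1 ?(ltW ln0)// ler_pM2l// ge0_ler_powR ?nnegrE ?ln_nat_ge//.
all: by rewrite ?(ltW l2) ?(ltW ln0) ?divr_ge0.
Qed.

Lemma cube_le_powR (rho n : nat) : (rho ^ 3 <= n)%N ->
  (rho * n)%:R <= n%:R `^ (4 / 3) :> R.
Proof.
move=> rn; have [->|n0] := posnP n; first by rewrite muln0 powR_ge0.
have -> : 4 / 3 = 3^-1 + 1 :> R by lra.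
rewrite powRD; last by rewrite gt_eqF.
rewrite powRr1// natrM ler_wpM2r//.
have -> : rho%:R = (rho%:R `^ 3) `^ 3^-1 :> R.
  by rewrite -powRrM divff// powRr1.
by rewrite powR_mulrn// -natrX ge0_ler_powR ?nnegrE ?ler_nat ?invr_ge0.
Qed.

Lemma pow5_le_powR (k : nat) : (1 <= k)%N ->
  (k.+2 ^ 5)%:R <= 3 ^+ 5 * k%:R `^ (11 / 2) :> R.
Proof.
move=> k1; apply: (@le_trans _ _ ((3 * k) ^ 5)%:R).
  by rewrite ler_nat leq_exp2r//; lia.
rewrite natrX natrM exprMn ler_pM2l ?exprn_gt0//.
rewrite -powR_mulrn// ler_powR ?ler1n//; lra.
Qed.

Lemma exploration_time (c : nat) : exists C : R, 0 < C /\
  forall n k rho : nat, (2 <= n)%N -> (1 <= k)%N -> (rho ^ 3 <= n)%N ->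
  (c * ((trunc_log 2 n).+1 * (k.+2 ^ 5 * (rho * n))))%:R <=
    exploration_bound C n k.
Proof.
have l2 : 0 < ln 2 :> R by rewrite ln_gt0// ltr1n.
(* [c.+1] instead of [c] makes the constant positive. *)
exists (c.+1%:R * (2 / ln 2) * 3 ^+ 5 / ln 2 `^ (3 / 2)); split.
  by rewrite !mulr_gt0 ?invr_gt0 ?powR_gt0 ?exprn_gt0.
move=> n k rho n2 k1 rn.
have ln0 : 0 <= ln n%:R :> R by apply: ltW; apply: lt_le_trans l2 (ln_nat_ge n2).
have h1 : (trunc_log 2 n).+1%:R <=
    2 / ln 2 * (ln n%:R `^ (5 / 2) / ln 2 `^ (3 / 2)) :> R.
  apply: le_trans (trunc_log_le_ln n2) _; rewrite ler_pM2l ?divr_gt0//.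
  exact: ln_le_powR.
have h2 := cube_le_powR rn; have h3 := pow5_le_powR k1.
rewrite natrM [X in _ * X]natrM [X in _ * (_ * X)]natrM.
have h := ler_pM _ _ h1 (ler_pM _ _ h3 h2).
have {}h := ler_pM _ _ (_ : c%:R <= c.+1%:R) (h _ _ _ _).
apply: le_trans (h _ _ _ _ _ _ _) _; rewrite ?mulr_ge0 ?ler_nat//.
rewrite /exploration_bound le_eqVlt; apply/orP; left; apply/eqP.
by rewrite -!mulrA; ring.
Qed.

End RealBounds.

(** * From infinite snapshot sequences back to finite temporal graphs *)

Theorem theorem2 (R : realType) :
  exists C : R, 0 < C /\
    forall (V : finType) (T k : nat) (G : temporal_graph V T),
      (2 <= #|V|)%N -> (1 <= k)%N ->
      always_connected G ->
      (treewidth (underlying_graph G) <= k)%N ->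
      exploration_bound C #|V| k <= T%:R ->
      forall v0 : V, exists w : seq (temporal_step V T),
        [/\ temporal_walk G v0 w,
            uses_only_first `|Num.ceil (exploration_bound C #|V| k)|%N w &
            forall v : V, v \in visited v0 w].
Proof.
have [c cP] := exploration_trip.
have [C [C0 CP]] := exploration_time R c.
exists C; split=> // V T k G V2 k1 conG twG bT v0.
have V1 : 1 < #|V|%:R :> R by rewrite ltr1n.
have b0 : 0 < exploration_bound C #|V| k.
  by rewrite /exploration_bound !mulr_gt0 ?powR_gt0 ?ln_gt0 ?ltr0n//; lia.
case: T G conG twG bT => [|T] G conG twG bT.
  by have := lt_le_trans b0 bT; rewrite ltxx.
(* Times beyond the last snapshot fall back to the first one, which keeps [H] connected at all
   times; [pT] shows that the trip ends before they occur. *)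
pose H t := G (inord t).
have H_conn t : connected_graph (H t) by exact: conG.
have H_sub t x y : H t x y -> underlying_graph G x y.
  by move=> xy; apply/existsP; exists (inord t).
have [D wD] := treewidth_decomposition (underlying_graph G).
have wk : ((td_width D).+2 <= k.+2)%N by rewrite wD.
have [rho rV rP] := cP V H _ D k.+2 H_conn H_sub wk (ltnW V2).
have := CP _ k rho V2 k1 rV.
have [y [p [wp + _ vis]]] := rP v0; rewrite add0n => <- pb.
have pT : (0 + size p <= T.+1)%N by rewrite add0n -(ler_nat R); exact: le_trans pb bT.
have [tw wt wv] := walk_stepsP pT wp.
exists (walk_steps T 0 v0 p); split => //; last first.
  by move=> v; apply: wv; apply: vis; rewrite inE.
have pC : (size p <= `|Num.ceil (exploration_bound C #|V| k)|)%N.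
  have : ((size p)%:Z <= Num.ceil (exploration_bound C #|V| k))%R.
    by rewrite -(ler_int R); apply: le_trans pb (ceil_ge _).
  by lia.
move: wt; rewrite all_map /uses_only_first; apply: sub_all => u /= ut.
exact: leq_trans ut pC.
Qed.
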